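(* Let $(\mathcal{G},X,T)$ be a decomposed graph of groups without circuit. Let $u\ne1$ be an element of $\pi_1(\mathcal{G},X)$ and $\mathcal{Z}(u)$ the centralizer of $u$ in $\pi_1(\mathcal{G},X)$. Then one of the following cases occurs, with the stated conclusion: (i) $u$ is in a vertex subgroup $G_s$; in that case $\mathcal{Z}(u)$ is the centralizer of $u$ in $G_s$. (ii) $u$ is in a conjugate of a vertex subgroup. (iii) $u$ is not in a conjugate of a vertex subgroup; in that case $\mathcal{Z}(u)$ is infinite cyclic.
   Context: A finite graph $X$ consists of finite sets $\mathcal{A}_X$ (edges) and $\mathcal{S}_X$ (vertices), a fixed-point-free involution $a\mapsto -a$ of $\mathcal{A}_X$, and maps $\mathrm{o},\mathrm{e}:\mathcal{A}_X\to\mathcal{S}_X$ (origin, end) with $\mathrm{e}(a)=\mathrm{o}(-a)$. An orientation is a subset $\mathcal{A}_X^+\subset\mathcal{A}_X$ containing exactly one of $a,-a$ for each $a$. A graph of groups $(\mathcal{G},X)$ is a finite connected oriented graph $X$ with vertex groups $G_s$ ($s\in\mathcal{S}_X$), edge groups $G_a$ ($a\in\mathcal{A}_X^+$), and monomorphisms $f_a:G_a\to G_{\mathrm{o}(a)}$, $f_{-a}:G_a\to G_{\mathrm{e}(a)}$ for $a\in\mathcal{A}_X^+$. A decomposed graph of groups $(\mathcal{G},X,T)$ is a graph of groups together with a maximal tree $T$ of $X$. Its fundamental group $\pi_1(\mathcal{G},X)$ is the quotient of the free product of all $G_s$ and the free group on $\{t_a: a\in\mathcal{A}_X\}$ by the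 relations $f_a(h)=t_af_{-a}(h)t_a^{-1}$ ($a\in\mathcal{A}_X^+$, $h\in G_a$), $t_{-a}=t_a^{-1}$ ($a\in\mathcal{A}_X$), $t_a=1$ ($a\in\mathcal{A}_T$). Each $G_s$ embeds naturally in $\pi_1(\mathcal{G},X)$ and is identified with its image (a vertex subgroup). For $a\in\mathcal{A}_X^+$, put $G_a^-=f_a(G_a)\subset G_{\mathrm{o}(a)}$, $G_a^+=f_{-a}(G_a)\subset G_{\mathrm{e}(a)}$ (as subgroups of $\pi_1(\mathcal{G},X)$), and $\varphi_a=f_{-a}\circ f_a^{-1}:G_a^-\to G_a^+$; also $G_{-a}^{\mp}=G_a^{\pm}$ and $\varphi_{-a}=\varphi_a^{-1}$. Circuits. Let $u\in G_s$. A circuit at $u$ with origin $s$ consists of: a closed path $(a_1,\dots,a_n)$ in $X$, $n\ge0$, from $s_0=s$ to $s_n=s$ (with $s_i=\mathrm{e}(a_i)=\mathrm{o}(a_{i+1})$ for $0<i<n$; if $n=0$ the path is the single vertex $s$); elements $c_i^-\in G_{a_i}^-$, $c_i^+\in G_{a_i}^+$ with $c_i^+=\varphi_{a_i}(c_i^-)$, $i=1,\dots,n$; and elements $h_i\in G_{s_i}$, $i=0,\dots,n$, such that, if $n=0$, $u=h_0uh_0^{-1}$, and if $n\ge1$, $u=h_0c_1^-h_0^{-1}$, $c_i^+=h_ic_{i+1}^-h_i^{-1}$ for $1\le i\le n-1$, and $c_n^+=h_nuh_n^{-1}$. The circuit is trivial if $n=0$. It is reduced if there is no index $1\le i\le n-1$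 with $a_{i+1}=-a_i$ and $h_i\in G_{a_i}^+$. The graph of groups is without circuit if for every $u\neq1$ (in a vertex subgroup), every reduced circuit at $u$ is trivial. *)

(* Defs.v *)
From HB Require Import structures.
From mathcomp Require Import all_boot.
From mathcomp Require Import boolp classical_sets functions cardinality.

Set Implicit Arguments.
Unset Strict Implicit.
Unset Printing Implicit Defensive.

Local Open Scope group_scope.
Local Open Scope classical_set_scope.
Local Open Scope quotient_scope.

Record graph := Graph {
  vertex : finType;
  edge : finType;
  einv : edge -> edge;
  einvK : involutive einv;
  einv_neq : forall a : edge, einv a != a;
  origin : edge -> vertex
}.

Definition terminus (X : graph) (a : edge X) : vertex X := origin (einv a).

(* [walk E s t p]: [p] is a path from [s] to [t] whose edges all lie in [E];
   the empty path at [s] is allowed. *)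
Fixpoint walk (X : graph) (E : {set edge X}) (s t : vertex X)
    (p : seq (edge X)) : bool :=
  if p is a :: p' then
    [&& a \in E, origin a == s & walk E (terminus a) t p']
  else s == t.

Definition reduced_path (X : graph) (p : seq (edge X)) : bool :=
  sorted (fun a b => b != einv a) p.

Definition is_subgraph (X : graph) (V : {set vertex X}) (E : {set edge X}) :=
  forall a : edge X, a \in E -> (einv a \in E) && (origin a \in V).

Definition is_connected (X : graph) (V : {set vertex X}) (E : {set edge X}) :=
  forall s t : vertex X, s \in V -> t \in V -> exists p, walk E s t p.

Definition is_tree (X : graph) (V : {set vertex X}) (E : {set edge X}) :=
  [/\ is_subgraph V E,
      exists s, s \in V,
      is_connected V E
    & forall s p, walk E s s p -> reduced_path p -> p = [::]].

Definition is_maximal_tree (X : graph) (V : {set vertex X})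
    (E : {set edge X}) :=
  is_tree V E /\
  forall V' E', is_tree V' E' -> V \subset V' -> E \subset E' ->
    V' = V /\ E' = E.

Definition is_orientation (X : graph) (O : {set edge X}) :=
  forall a : edge X, (a \in O) (+) (einv a \in O).

(* [groupType] only adds a choice operator to a possibly infinite group, which
   every type has classically. *)
Record graph_of_groups := GraphOfGroups {
  gg_graph :> graph;
  gg_connected : is_connected [set: vertex gg_graph]%SET [set: edge gg_graph]%SET;
  gg_pos : {set edge gg_graph};
  gg_posP : is_orientation gg_pos;
  vertex_group : vertex gg_graph -> groupType;
  edge_group : {a : edge gg_graph | a \in gg_pos} -> groupType;
  (* [emb_orig a] is f_a and [emb_term a] is f_{-a} *)
  emb_orig : forall a : {a : edge gg_graph | a \in gg_pos},
    {multiplicative edge_group a -> vertex_group (origin (val a))};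
  emb_term : forall a : {a : edge gg_graph | a \in gg_pos},
    {multiplicative edge_group a -> vertex_group (terminus (val a))};
  emb_orig_inj : forall a, injective (emb_orig a);
  emb_term_inj : forall a, injective (emb_term a)
}.

Record decomposed_gg := DecomposedGG {
  dg_gg :> graph_of_groups;
  tree_vertex : {set vertex dg_gg};
  tree_edge : {set edge dg_gg};
  tree_maximal : is_maximal_tree tree_vertex tree_edge
}.

Section FundamentalGroup.
Variable D : decomposed_gg.

(* The quotient of the free product of the vertex groups and the free group on
   the edges, built as formal group expressions modulo the least congruence
   containing the group axioms, the multiplication of each vertex group, and
   the three families of relations on the stable letters. *)
Inductive expr :=
  | EVert (s : vertex D) (g : vertex_group s)
  | EStable (a : edge D)
  | EOne
  | EMul (x y : expr)
  | EInv (x : expr).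

Inductive expr_eq : expr -> expr -> Prop :=
  | expr_refl x : expr_eq x x
  | expr_sym x y : expr_eq x y -> expr_eq y x
  | expr_trans x y z : expr_eq x y -> expr_eq y z -> expr_eq x z
  | expr_mul x x' y y' :
      expr_eq x x' -> expr_eq y y' -> expr_eq (EMul x y) (EMul x' y')
  | expr_inv x x' : expr_eq x x' -> expr_eq (EInv x) (EInv x')
  | expr_mulA x y z : expr_eq (EMul x (EMul y z)) (EMul (EMul x y) z)
  | expr_mul1 x : expr_eq (EMul EOne x) x
  | expr_mulV x : expr_eq (EMul (EInv x) x) EOne
  | expr_vert s (g h : vertex_group s) :
      expr_eq (EVert (g * h)) (EMul (EVert g) (EVert h))
  | expr_edge a (h : edge_group a) :
      expr_eq (EVert (emb_orig a h))
        (EMul (EMul (EStable (val a)) (EVert (emb_term a h)))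
           (EInv (EStable (val a))))
  | expr_stableV a : expr_eq (EStable (einv a)) (EInv (EStable a))
  | expr_tree a : a \in tree_edge D -> expr_eq (EStable a) EOne.

HB.instance Definition _ := gen_eqMixin expr.
HB.instance Definition _ := gen_choiceMixin expr.

Definition expr_eqb : rel expr := fun x y => `[< expr_eq x y >].

Lemma expr_eqb_refl : reflexive expr_eqb.
Proof. by move=> x; apply/asboolP/expr_refl. Qed.

Lemma expr_eqb_sym : symmetric expr_eqb.
Proof. by move=> x y; apply: asbool_equiv_eq; split; apply: expr_sym. Qed.

Lemma expr_eqb_trans : transitive expr_eqb.
Proof.
by move=> y x z /asboolP xy /asboolP yz; apply/asboolP/(expr_trans xy yz).
Qed.

Canonical expr_equiv :=
  EquivRel expr_eqb expr_eqb_refl expr_eqb_sym expr_eqb_trans.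

Definition pi1 : Type := {eq_quot expr_equiv}.
HB.instance Definition _ := Choice.on pi1.

Definition pi1_class (x : expr) : pi1 := (\pi_{eq_quot expr_equiv} x)%qT.
Definition pi1_repr (x : pi1) : expr := repr (x : {eq_quot expr_equiv}).

Lemma pi1_reprK x : pi1_class (pi1_repr x) = x.
Proof. exact: reprK. Qed.

Lemma pi1_classP x y : pi1_class x = pi1_class y <-> expr_eq x y.
Proof. by split=> [/eqmodP/asboolP|xy]; [|apply/eqmodP/asboolP]. Qed.

Definition pi1_one : pi1 := pi1_class EOne.
Definition pi1_mul (x y : pi1) : pi1 :=
  pi1_class (EMul (pi1_repr x) (pi1_repr y)).
Definition pi1_inv (x : pi1) : pi1 := pi1_class (EInv (pi1_repr x)).

Lemma pi1_repr_class x : expr_eq (pi1_repr (pi1_class x)) x.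
Proof. by apply/pi1_classP; rewrite pi1_reprK. Qed.

Lemma pi1_mulE x y :
  pi1_mul (pi1_class x) (pi1_class y) = pi1_class (EMul x y).
Proof. by apply/pi1_classP; apply: expr_mul; apply: pi1_repr_class. Qed.

Lemma pi1_invE x : pi1_inv (pi1_class x) = pi1_class (EInv x).
Proof. by apply/pi1_classP; apply: expr_inv; apply: pi1_repr_class. Qed.

Lemma pi1_mulA : associative pi1_mul.
Proof.
move=> x y z; rewrite -(pi1_reprK x) -(pi1_reprK y) -(pi1_reprK z) !pi1_mulE.
by apply/pi1_classP; apply: expr_mulA.
Qed.

Lemma pi1_mul1 : left_id pi1_one pi1_mul.
Proof.
move=> x; rewrite -(pi1_reprK x) pi1_mulE.
by apply/pi1_classP; apply: expr_mul1.
Qed.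

Lemma pi1_mulV : left_inverse pi1_one pi1_inv pi1_mul.
Proof.
move=> x; rewrite -(pi1_reprK x) pi1_invE pi1_mulE.
by apply/pi1_classP; apply: expr_mulV.
Qed.

Lemma pi1_mulVr : right_inverse pi1_one pi1_inv pi1_mul.
Proof.
move=> x; rewrite -[LHS]pi1_mul1 -[X in pi1_mul X _](pi1_mulV (pi1_inv x)).
by rewrite -pi1_mulA [X in pi1_mul _ X]pi1_mulA pi1_mulV pi1_mul1 pi1_mulV.
Qed.

Lemma pi1_mul1r : right_id pi1_one pi1_mul.
Proof. by move=> x; rewrite -(pi1_mulV x) pi1_mulA pi1_mulVr pi1_mul1. Qed.

HB.instance Definition _ := isGroup.Build pi1
  pi1_mulA pi1_mul1 pi1_mul1r pi1_mulV pi1_mulVr.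

Definition iota_vert (s : vertex D) (g : vertex_group s) : pi1 :=
  pi1_class (EVert g).

Definition vertex_subgroup (s : vertex D) : set pi1 := range (@iota_vert s).

(* The graph of phi_a, for every edge [a]; by definition its domain is G_a^-
   and its range is G_a^+. *)
Inductive edge_iso : edge D -> pi1 -> pi1 -> Prop :=
  | edge_iso_pos a (h : edge_group a) :
      edge_iso (val a) (iota_vert (emb_orig a h)) (iota_vert (emb_term a h))
  | edge_iso_neg a (h : edge_group a) :
      edge_iso (einv (val a))
        (iota_vert (emb_term a h)) (iota_vert (emb_orig a h)).

Definition edge_subgroup_plus (a : edge D) : set pi1 :=
  [set y | exists x, edge_iso a x y].

(* The i-th step of a circuit: a_i, c_i^-, c_i^+ and h_i.  A circuit is the
   element h_0 followed by its list of steps. *)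
Record step := Step {
  st_edge : edge D;
  st_minus : pi1;
  st_plus : pi1;
  st_h : pi1
}.

(* With s_i the current vertex, s the final vertex, x = c_i^+ (or x = u when
   i = 0) and h = h_i, the steps of index > i complete the circuit at u. *)
Fixpoint circuit_from (u : pi1) (s si : vertex D) (x h : pi1)
    (p : seq step) : Prop :=
  vertex_subgroup si h /\
  if p is st :: p' then
    [/\ origin (st_edge st) = si,
        edge_iso (st_edge st) (st_minus st) (st_plus st),
        x = h * st_minus st * h^-1
      & circuit_from u s (terminus (st_edge st)) (st_plus st) (st_h st) p']
  else si = s /\ x = h * u * h^-1.

Definition is_circuit (u : pi1) (s : vertex D) (h0 : pi1) (p : seq step) :=
  vertex_subgroup s u /\ circuit_from u s s u h0 p.

Definition reduced_circuit (p : seq step) : Prop :=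
  forall p1 st st' p2, p = p1 ++ [:: st, st' & p2] ->
    ~ (st_edge st' = einv (st_edge st) /\
       edge_subgroup_plus (st_edge st) (st_h st)).

Definition without_circuit : Prop :=
  forall (u : pi1) (s : vertex D) (h0 : pi1) (p : seq step),
    u <> 1 -> is_circuit u s h0 p -> reduced_circuit p -> p = [::].

Definition centralizer (u : pi1) : set pi1 := [set z | commute z u].

Definition conj_set (g : pi1) (H : set pi1) : set pi1 :=
  [set g * x * g^-1 | x in H].

Definition in_conj_vertex (u : pi1) : Prop :=
  exists (s : vertex D) (g : pi1), conj_set g (vertex_subgroup s) u.

Definition infinite_cyclic (H : set pi1) : Prop :=
  infinite_set H /\
  exists z : pi1, H = [set x | exists n : nat, x = z ^+ n \/ x = z ^- n].

End FundamentalGroup.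

(* Main.v *)
Require Import Defs.
From HB Require Import structures.
From mathcomp Require Import all_boot.
From mathcomp Require Import order ssralg ssrnum ssrint zify.
From mathcomp Require Import boolp classical_sets functions cardinality.

Set Implicit Arguments.
Unset Strict Implicit.
Unset Printing Implicit Defensive.

(** The group [pi1 D] acts on the Bass-Serre tree of the graph of groups, and
    the theorem is read off this action.

    The tree is built by hand.  Fix a base vertex [s0].  An element of [pi1 D],
    or rather of a coset of a vertex group, is written as a normal form: a
    reduced list of pairs [(x, a)], where [x] is the chosen representative of
    a coset of the domain of phi_a and [a] an edge, followed by an element of
    the last vertex group.  The lists alone are the vertices of the tree, and
    the distance of two of them is the number of entries outside their longest
    common prefix.  Vertex groups and stable letters act on normal forms; the
    defining relations of [pi1 D] hold for these actions ([word_eq]), which is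
    the van der Waerden argument for the normal form theorem, and the action
    preserves the distance ([prefix_dist_wact]).  Evaluating a normal form in
    [pi1 D] is equivariant ([eval_wact]), so that every element is the value
    of the normal form to which it moves the trivial one.

    Centralizers in a vertex group.  Let [u <> 1] lie in the vertex group at
    [s], take [s] as base vertex and let [z] commute with [u].  Then [u] fixes
    the trivial list, hence also its image under [z], hence every edge of the
    path between the two.  The group elements met along this path are exactly
    the data of a reduced circuit at [u] ([circuit_of_fixed_path],
    [circuit_steps_reduced]).  As there is no circuit, the path is empty, and
    [z] lies in the vertex group ([centralizer_vertex]).

    Centralizers of the other elements.  If [u] is not conjugate into a vertex
    group, it fixes no vertex of the tree; nor does any element exchange two
    neighbours, because an element changes the exponent sum of all lists by
    one and the same integer, while neighbours have different sums.  So [u] is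
    a translation along an axis, and everything that commutes with [u]
    translates the same axis, by an amount that depends additively on the
    element ([translation_length]).  An element [z] of the centralizer with
    translation length zero fixes a vertex, hence is conjugate into a vertex
    group; if [z] were not [1], the first case would put [u], which commutes
    with [z], in the same conjugate of that group.  So the centralizer embeds
    into the integers, and it is infinite because it contains the powers of
    [u] ([centralizer_infinite_cyclic]). *)

(** * The prefix metric on lists *)

Section PrefixMetric.
Variable A : eqType.
Implicit Types x y z w : seq A.

Fixpoint lcp x y : nat :=
  match x, y with
  | a :: x', b :: y' => if a == b then (lcp x' y').+1 else 0
  | _, _ => 0
  end.

Definition prefix_dist x y : nat := size x + size y - 2 * lcp x y.

Lemma lcpC x y : lcp x y = lcp y x.
Proof. by elim: x y => [|a x IH] [|b y] //=; rewrite eq_sym IH. Qed.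

Lemma lcp_size x y : lcp x y <= size x.
Proof. by elim: x y => [|a x IH] [|b y] //=; case: eqP => // _; exact: IH. Qed.

Lemma lcp_refl x : lcp x x = size x.
Proof. by elim: x => //= a x ->; rewrite eqxx. Qed.

Lemma lcp_ultra x y z : minn (lcp x y) (lcp y z) <= lcp x z.
Proof.
elim: x y z => [|a x IH] [|b y] [|c z] //=; rewrite ?minn0 ?min0n //.
have [<-|] := eqVneq a b; last by rewrite min0n.
by case: eqP => // _; rewrite minnSS ltnS.
Qed.

Lemma lcp_take k x y : lcp (take k x) y = minn k (lcp x y).
Proof.
elim: k x y => [|k IH] [|a x] [|b y] //=; rewrite ?minn0 ?min0n //.
by case: eqP => _; rewrite ?minn0 // IH minnSS.
Qed.

Lemma prefix_dist_refl x : prefix_dist x x = 0.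
Proof. by rewrite /prefix_dist lcp_refl; lia. Qed.

Lemma prefix_distC x y : prefix_dist x y = prefix_dist y x.
Proof. by rewrite /prefix_dist lcpC addnC. Qed.

(** The ultrametric inequality for common prefixes makes the metric that of a
    tree: of the three sums of opposite distances, the two largest agree. *)
Lemma prefix_dist_four x y z w :
  prefix_dist x y + prefix_dist z w <=
    maxn (prefix_dist x z + prefix_dist y w) (prefix_dist x w + prefix_dist y z).
Proof.
rewrite /prefix_dist.
have := lcp_size x y; have := lcp_size y x; have := lcp_size z w.
have := lcp_size w z; have := lcp_size x z; have := lcp_size z x.
have := lcp_size y w; have := lcp_size w y; have := lcp_size x w.
have := lcp_size w x; have := lcp_size y z; have := lcp_size z y.
have := lcp_ultra x z y; have := lcp_ultra x w y.
have := lcp_ultra z x w; have := lcp_ultra z y w.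
rewrite (lcpC y x) (lcpC w z) (lcpC z x) (lcpC w y) (lcpC w x) (lcpC z y).
lia.
Qed.

Lemma prefix_dist_even x y z :
  exists k, prefix_dist x y + prefix_dist y z + prefix_dist x z = 2 * k.
Proof.
exists (size x + size y + size z - lcp x y - lcp y z - lcp x z).
rewrite /prefix_dist.
have := lcp_size x y; have := lcp_size y x; have := lcp_size x z.
have := lcp_size z x; have := lcp_size y z; have := lcp_size z y.
rewrite (lcpC y x) (lcpC z x) (lcpC z y); lia.
Qed.

(** Neighbours in the tree differ by one last entry: a step from [x] to [y]
    drops the last entry of [x], or, when [x] is a prefix of [y], adds one. *)
Lemma prefix_dist_step x y : 0 < prefix_dist x y ->
  exists p, [/\ prefix_dist x p = 1, (prefix_dist p y).+1 = prefix_dist x y &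
    (exists k, p = take k x) \/ (exists k, p = take k y)].
Proof.
rewrite /prefix_dist => dxy.
have := lcp_size x y; have := lcp_size y x; rewrite lcpC => ly lx.
have [lt|ge] := ltnP (lcp x y) (size x).
  exists (take (size x).-1 x); split; last by left; exists (size x).-1.
    by rewrite lcpC lcp_take lcp_refl size_take; case: ifP; lia.
  by rewrite lcp_take size_take; case: ifP; lia.
exists (take (size x).+1 y); split; last by right; exists (size x).+1.
  by rewrite lcpC lcp_take lcpC size_take; case: ifP; lia.
by rewrite lcp_take lcp_refl size_take; case: ifP; lia.
Qed.

Lemma prefix_dist_cons a x y : prefix_dist (a :: x) (a :: y) = prefix_dist x y.
Proof. by rewrite /prefix_dist /= eqxx; lia. Qed.

Lemma prefix_dist_eq0 x y : prefix_dist x y = 0 -> x = y.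
Proof.
rewrite /prefix_dist => d0.
have lx := lcp_size x y; have ly := lcp_size y x; rewrite lcpC in ly.
have {d0 lx ly} : lcp x y = size x /\ size y = size x by lia.
elim: x y => [|a x IH] [|b y] //= [] //.
by case: eqP => // <- [ex] [ey]; rewrite (IH y).
Qed.

End PrefixMetric.

(** * Walks and maximal trees *)

Section Walks.
Variable X : graph.
Implicit Types (E : {set edge X}) (V : {set vertex X}) (p q : seq (edge X)).

Lemma terminus_einv (a : edge X) : terminus (einv a) = origin a.
Proof. by rewrite /terminus einvK. Qed.

Lemma walk_cat E s r t p q : walk E s r p -> walk E r t q -> walk E s t (p ++ q).
Proof.
elim: p s => /= [|a p IH] s; first by move/eqP->.
by move=> /and3P[-> -> w] wq; rewrite IH.
Qed.

Lemma walk_catP E s t p q : walk E s t (p ++ q) ->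
  exists2 r, walk E s r p & walk E r t q.
Proof.
elim: p s => /= [|a p IH] s; first by exists s.
by move=> /and3P[-> -> /IH[r wp wq]]; exists r.
Qed.

Lemma walk_sub E E' s t p : E \subset E' -> walk E s t p -> walk E' s t p.
Proof.
move=> /fintype.subsetP sE; elim: p s => //= a p IH s /and3P[aE -> w].
by rewrite sE // IH.
Qed.

Definition path_inv p := rev (map (@einv X) p).

Lemma walk_inv V E s t p :
  is_subgraph V E -> walk E s t p -> walk E t s (path_inv p).
Proof.
move=> sub; elim: p s => /= [|a p IH] s; first by rewrite eq_sym.
move=> /and3P[aE /eqP <- w]; rewrite /path_inv /= rev_cons -cats1.
apply: walk_cat (IH _ w) _ => /=.
by have /andP[-> _] := sub _ aE; rewrite terminus_einv !eqxx.
Qed.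

Lemma not_reduced p : ~~ reduced_path p ->
  exists p1 b p2, p = p1 ++ [:: b, einv b & p2].
Proof.
elim: p => // a [|b p] IH //=; rewrite /reduced_path /= negb_and negbK.
case/orP => [/eqP ->|/IH[p1 [c [p2 e]]]]; first by exists [::], a, p.
by exists (a :: p1), c, p2; rewrite e.
Qed.

Lemma reduced_behead a p : reduced_path (a :: p) -> reduced_path p.
Proof. exact: path_sorted. Qed.

Lemma leave_set E V s t p : s \in V -> t \notin V -> walk E s t p ->
  exists a, [/\ a \in E, origin a \in V & terminus a \notin V].
Proof.
elim: p s => /= [|a p IH] s sV tV; first by move/eqP=> e; rewrite -e sV in tV.
move=> /and3P[aE /eqP e w].
have [eV|eV] := boolP (terminus a \in V); first exact: IH eV tV w.
by exists a; rewrite e.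
Qed.

(** An edge [a] that leaves the vertex set [V] of a tree can be added to the
    tree: its end is a leaf, which a reduced walk visits only at its ends. *)
Section Leaf.
Variables (V : {set vertex X}) (E : {set edge X}) (a : edge X).
Hypotheses (treeE : is_tree V E) (oV : origin a \in V)
  (tV : terminus a \notin V).
Let v := terminus a.
Let E' := ([set a; einv a] :|: E)%SET.

Let subE : is_subgraph V E. Proof. by case: treeE. Qed.

Let originE b : b \in E -> origin b != v.
Proof. by move=> /subE/andP[_ bV]; apply: contraNneq tV => e; rewrite -/v -e. Qed.

Let terminusE b : b \in E -> terminus b != v.
Proof. by move=> /subE/andP[+ _]; apply: originE. Qed.

Let oNv : origin a != v.
Proof. by apply: contraNneq tV => e; rewrite -/v -e. Qed.

Lemma leaf_edge b : b \in E' -> origin b = v -> b = einv a.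
Proof.
rewrite !inE => /orP[/orP[]/eqP -> //|/originE/eqP//].
by move=> e; have := oNv; rewrite e eqxx.
Qed.

Lemma avoid_leaf s t p : walk E' s t p -> reduced_path p ->
  s != v -> t != v -> walk E s t p.
Proof.
elim: p s => //= b p IH s /and3P[bE /eqP ob w] red sv tv.
have [bE0|bE0] := boolP (b \in E).
  by rewrite ob eqxx (IH _ w (reduced_behead red)) // terminusE.
have ba : b = a.
  move: bE; rewrite !inE (negPf bE0) orbF => /orP[]/eqP // e.
  by rewrite -ob e eqxx in sv.
case: p w red {IH} => [/= /eqP e|c p /= /and3P[cE /eqP oc _]].
  by rewrite -e ba eqxx in tv.
by rewrite (leaf_edge cE) ?ba ?eqxx // oc ba.
Qed.

Lemma leaf_subgraph : is_subgraph (v |: V)%SET E'.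
Proof.
move=> b; rewrite !inE => /orP[/orP[]/eqP->|bE].
- by rewrite eqxx oV !orbT.
- by rewrite einvK !eqxx.
- by have /andP[-> ->] := subE bE; rewrite !orbT.
Qed.

Lemma leaf_tree : is_tree (v |: V)%SET E'.
Proof.
have sEE : E \subset E' by apply: finset.subsetUr.
have [_ _ conn acyc] := treeE.
have wa : walk E' (origin a) v [:: a] by rewrite /= !inE !eqxx.
have wa' : walk E' v (origin a) [:: einv a].
  by rewrite /= terminus_einv !inE !eqxx orbT.
split.
- exact: leaf_subgraph.
- by exists v; rewrite !inE eqxx.
- have to_o s : s \in (v |: V)%SET -> exists p, walk E' s (origin a) p.
    rewrite !inE => /orP[/eqP->|sV]; first by exists [:: einv a].
    by have [p w] := conn _ _ sV oV; exists p; apply: walk_sub w.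
  move=> s t /to_o[p wp] /to_o[q wq]; exists (p ++ path_inv q).
  by apply: walk_cat wp _; apply: walk_inv wq; exact: leaf_subgraph.
- move=> s p w red; have [sv|sv] := eqVneq s v; last first.
    exact: acyc (avoid_leaf w red sv sv) red.
(* A reduced closed walk at the leaf would start with [einv a] and end with [a],
   and the part in between would be a reduced closed walk in [E]. *)
  rewrite {}sv in w; case: p w red => // b p /= /and3P[bE /eqP ob w] red.
  have eb := leaf_edge bE ob; rewrite eb terminus_einv in w.
  case/lastP: p w red => [/= /eqP e|q c].
    by have := oNv; rewrite e eqxx.
  rewrite -cats1 => /walk_catP[r wq /= /and3P[cE /eqP oc /eqP tc]] red.
  have ec : c = a.
    rewrite -[c]einvK; have /andP[cE' _] := leaf_subgraph cE.
    by rewrite (leaf_edge cE' tc) einvK.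
  have redq : reduced_path q.
    by move: (reduced_behead red); rewrite /reduced_path; case: (q) => //= x y;
      rewrite cat_path => /andP[].
  rewrite -oc ec in wq.
  have q0 := acyc _ _ (avoid_leaf wq redq oNv oNv) redq.
  by move: red; rewrite q0 ec eb /reduced_path /= einvK eqxx.
Qed.
End Leaf.

(** By connectedness some edge leaves a tree that misses a vertex, and this
    edge extends the tree. *)
Lemma maximal_tree_spans V E :
    is_connected [set: vertex X]%SET [set: edge X]%SET ->
  is_maximal_tree V E -> forall s, s \in V.
Proof.
move=> conn [tree maxT] t; apply: contraT => tV.
have [_ [s sV] _ _] := tree.
have [p w] := conn s t (finset.in_setT _) (finset.in_setT _).
have [a [_ oV aV]] := leave_set sV tV w.
have [eV _] := maxT _ _ (leaf_tree tree oV aV)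
  (finset.subsetUr _ _) (finset.subsetUr _ _).
by move: aV; rewrite -eV !inE eqxx.
Qed.

End Walks.

Local Open Scope group_scope.

(** * Translations of trees and infinite cyclic centralizers *)

(** The vertices of a tree enter only through their distance [d], which is
    allowed to be zero for distinct points.  [dist_four] and [dist_even] say
    that the integral metric embeds in a tree with its branch points at
    integral positions, [dist_step] that geodesics run through points of [T],
    and [act_noinv] that no edge is inverted. *)
Record tree_action (G : groupType) (T : Type) (d : T -> T -> nat)
    (act : G -> T -> T) : Prop := TreeAction {
  dist_refl : forall x, d x x = 0;
  dist_sym : forall x y, d x y = d y x;
  dist_four : forall x y z w,
    (d x y + d z w <= maxn (d x z + d y w) (d x w + d y z))%N;
  dist_even : forall x y z, exists k, (d x y + d y z + d x z = 2 * k)%N;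
  dist_step : forall x y, (0 < d x y)%N ->
    exists2 p, d x p = 1%N & (d p y).+1 = d x y;
  actM : forall g h x, act (g * h) x = act g (act h x);
  act1 : forall x, act 1 x = x;
  act_isom : forall g x y, d (act g x) (act g y) = d x y;
  act_noinv : forall g x, d x (act g x) = 1%N -> d x (act g (act g x)) <> 0%N
}.

Section Hyperbolic.
Variables (G : groupType) (T : Type) (d : T -> T -> nat) (act : G -> T -> T).
Variable tree_d : tree_action d act.

Let d0 := dist_refl tree_d.
Let dC := dist_sym tree_d.
Let d4 := dist_four tree_d.
Let aM := actM tree_d.
Let iso := act_isom tree_d.

Lemma dist_triangle x y z : (d x z <= d x y + d y z)%N.
Proof. have := d4 x z y y; rewrite d0 (dC z y); lia. Qed.

Lemma dist0_eq x y z : d x y = 0%N -> d x z = d y z.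
Proof.
move=> xy; have := dist_triangle x y z; have := dist_triangle y x z.
by rewrite (dC y x); lia.
Qed.

Lemma four_far x y z w :
  (d x y + d z w < d x z + d y w)%N -> (d x z + d y w = d x w + d y z)%N.
Proof.
have := d4 x z y w; have := d4 x w y z; rewrite (dC w y) (dC z y) (dC w z).
lia.
Qed.

(** In what follows [u] moves every point by at least [len > 0]; the points
    which it moves by exactly [len] form its axis. *)
Section MinimalDisplacement.
Variables (u : G) (len : nat).
Hypothesis len_gt0 : (0 < len)%N.
Hypothesis len_min : forall x, (len <= d x (act u x))%N.

(** If [u] moved [x] back on itself, the neighbour [q] of [x] towards [u x]
    would satisfy [u q = p], the neighbour of [u x] towards [x].  For
    [len > 1] the point [q] would be displaced by less than [len], and for
    [len = 1] the element [u] would invert an edge. *)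
Lemma displacement_sq x :
  d x (act u x) = len -> d x (act u (act u x)) = (2 * len)%N.
Proof.
move=> dx; set y := act u x; set z := act u y.
have dyz : d y z = len by rewrite iso.
have dxz := dist_triangle x y z; rewrite -/y in dx.
have [k] := dist_even tree_d x y z; rewrite dx dyz => ek.
case: (ltnP (d x z) (2 * len)) => [lt2|]; last by lia.
exfalso.
have [q xq qy] : exists2 p, d x p = 1%N & (d p y).+1 = d x y.
  by apply: (dist_step tree_d); rewrite dx.
have [p yp px] : exists2 p, d y p = 1%N & (d p x).+1 = d y x.
  by apply: (dist_step tree_d); rewrite (dC y x) dx.
set q' := act u q.
have yq : d y q' = 1%N by rewrite iso.
have qz : d q' z = d q y by rewrite iso.
have pz := d4 p z y x.
have pq := d4 p q' y z.
have qp := d4 q p x y.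
move: (dC y p) (dC y q') (dC y x) (dC z x) (dC z y) (dC q x) => ? ? ? ? ? ?.
have pq0 : d p q' = 0%N by lia.
have := len_min q; rewrite -/q' (dC q) -(dist0_eq q pq0) dC => lq.
have len1 : len = 1%N by lia.
have xz0 : d x z = 0%N by lia.
by apply: (act_noinv tree_d (g := u) (x := x)) xz0; rewrite -/y -[RHS]len1.
Qed.

Lemma displacement_commute g x : commute g u -> d x (act u x) = len ->
  d (act g x) (act u (act g x)) = len.
Proof. by move=> gu dx; rewrite -aM -gu aM iso. Qed.

(** Geodesics that do not turn back locally do not turn back at all. *)
Lemma displacement_pow n x :
  d x (act u x) = len -> d x (act (u ^+ n) x) = (n * len)%N.
Proof.
move=> dx; pose p k := act (u ^+ k) x.
have p1 k : d (p k) (p k.+1) = len by rewrite /p expgSr aM iso.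
have p2 k : d (p k) (p k.+2) = (2 * len)%N.
  by rewrite /p !expgSr !aM iso displacement_sq.
have p0 : p 0 = x by rewrite /p expg0 (act1 tree_d).
rewrite -/(p n); elim/ltn_ind: n => -[|[|n]] IH.
- by rewrite p0 d0.
- by rewrite -{1}p0 p1 mul1n.
have IH1 := IH n.+1 (ltnSn _); have IH0 := IH n (leqnSn _).
have := d4 x (p n.+1) (p n) (p n.+2).
have := dist_triangle x (p n.+1) (p n.+2).
rewrite (dC (p n.+1) (p n)) !p1 p2 IH1 IH0 !mulSn; set m := (n * len)%N; lia.
Qed.

Section Axis.
(** The points [p n] run along the axis towards one of its ends, and the
    Busemann function of this end measures positions along the axis. *)
Variable x0 : T.
Hypothesis axis_x0 : d x0 (act u x0) = len.
Let p n := act (u ^+ n) x0.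

Let pS n : d (p n) (p n.+1) = len.
Proof. by rewrite /p expgSr aM iso. Qed.

Let p0 n : d x0 (p n) = (n * len)%N.
Proof. exact: displacement_pow. Qed.

(** Once [n * len] exceeds the distance of [x] from [x0], the geodesic from
    [x] to [p n] has merged with the axis. *)
Lemma busemann x :
  exists t : int, exists N, forall n, (N <= n)%N ->
    Posz (d x (p n)) = (t + Posz (n * len))%R.
Proof.
set N := (d x x0).+1.
exists (Posz (d x (p N)) - Posz (N * len))%R, N => n Nn.
rewrite -(subnKC Nn); elim: (n - N)%N => [|k IH]; first by rewrite addn0; lia.
rewrite addnS; move: IH; have := leq_addr k N; move: (N + k)%N => m Nm IH.
have far : (d x x0 < m * len)%N by nia.
have := @four_far x x0 (p m) (p m.+1).
have := dist_triangle x0 x (p m).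
rewrite (dC x0 x) pS !p0 mulSn; lia.
Qed.

(** The elements that commute with [u] fix the end of the axis, so that they
    change all Busemann heights by the same amount: the geodesics from [x] and
    from [y] have met on the way to [p n] and to its translate by [g^-1]. *)
Lemma busemann_shift g x y : commute g u -> exists N, forall n, (N <= n)%N ->
  (d (act g x) (p n) + d y (p n) = d x (p n) + d (act g y) (p n))%N.
Proof.
move=> gu; set y0 := act g^-1 x0.
have dg z n : d (act g z) (p n) = d z (act (u ^+ n) y0).
  rewrite -[RHS](iso g) /p /y0 -!aM; congr (d _ (act _ _)).
  by rewrite (commuteX n gu) mulgK.
exists (d x y + d y0 x0 + d x0 x + d y0 y).+1 => n Nn; rewrite !dg.
have far : (d x y + d y0 x0 + d x0 x + d y0 y < n * len)%N by nia.
have := @four_far x y (act (u ^+ n) y0) (p n).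
have := dist_triangle x0 x (p n); have := dist_triangle x0 y (p n).
have := dist_triangle (p n) (act (u ^+ n) y0) x0.
have := dist_triangle x (act (u ^+ n) y0) (p n).
have := dist_triangle y (act (u ^+ n) y0) (p n).
have := dist_triangle x0 x y.
rewrite iso p0; lia.
Qed.

(** A point of the axis at height zero is as far as [x0] from points far out
    on the axis, on either side, hence is [x0]. *)
Lemma busemann_eq0 x : d x (act u x) = len ->
  (exists N, forall n, (N <= n)%N -> d x (p n) = (n * len)%N) -> d x x0 = 0%N.
Proof.
(* As [q] and [p n] are both midpoints of [x0] and [p (n + n)], they agree, and
   their distance is that of [x] and [x0]. *)
move=> axis_x [N hN]; pose n := (maxn N (d x x0).+1).
have far : (d x x0 < n * len)%N by rewrite /n; nia.
have dxp := hN n (leq_maxl _ _).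
pose q := act (u ^+ n) x.
have dxq : d x q = (n * len)%N by apply: displacement_pow.
have dqp : d q (p n) = d x x0 by rewrite iso.
have dqpp : d q (p (n + n)) = (n * len)%N.
  by rewrite /p expgnDr aM iso.
have dpp : d (p n) (p (n + n)) = (n * len)%N.
  by rewrite /p expgnDr aM iso displacement_pow.
have := @four_far x x0 q (p n).
have := d4 (p n) q x0 (p (n + n)); rewrite p0 mulnDl (dC (p n) q).
have := p0 n.
rewrite (dC (p n) x0) (dC q x0).
lia.
Qed.
End Axis.
End MinimalDisplacement.

(** Choosing [x0] of minimal displacement puts it on the axis of [u]; [th z] is
    the Busemann height of [act z x0]. *)
Lemma translation_length (u : G) (x1 : T) :
    (forall x, d x (act u x) <> 0%N) ->
  exists th : G -> int,
    (forall z w, commute z u -> commute w u -> th (z * w)%g = (th z + th w)%R) /\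
    (forall z, commute z u -> th z = 0%R -> exists x, d x (act z x) = 0%N).
Proof.
move=> nofix.
have [|len] := @ex_minnP (fun n => `[< exists x, d x (act u x) = n >]).
  by exists (d x1 (act u x1)); apply/asboolP; exists x1.
move=> /asboolP[x0 axis_x0] lenP.
have len_min x : (len <= d x (act u x))%N by apply/lenP/asboolP; exists x.
have len_gt0 : (0 < len)%N by rewrite lt0n -axis_x0; apply/eqP/nofix.
have [th thP] := choice (fun z => busemann len_gt0 len_min axis_x0 (act z x0)).
exists th; split=> [z w zu wu|z zu thz].
  have [N1 h1] := thP z; have [N2 h2] := thP w; have [N3 h3] := thP (z * w).
  have [N4 h4] := busemann_shift len_gt0 len_min axis_x0 (act w x0) x0 zu.
  pose n := (maxn (maxn N1 N2) (maxn N3 N4)).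
  have e1 := h1 n ltac:(lia); have e2 := h2 n ltac:(lia).
  have e3 := h3 n ltac:(lia); have e4 := h4 n ltac:(lia).
  have e5 := displacement_pow len_gt0 len_min n axis_x0.
  by move: e3 e4; rewrite aM e5; lia.
exists x0; rewrite dC.
apply: (busemann_eq0 len_gt0 len_min axis_x0); first exact: displacement_commute.
have [N h] := thP z; exists N => n Nn.
by have := h n Nn; rewrite thz; lia.
Qed.
End Hyperbolic.

Local Open Scope classical_set_scope.

(** A group with an injective homomorphism to the integers is generated by an
    element [z] of least positive image: divide with remainder. *)
Lemma centralizer_infinite_cyclic (D : decomposed_gg) (u : pi1 D)
    (th : pi1 D -> int) :
    u <> 1 ->
    (forall z w, commute z u -> commute w u -> th (z * w)%g = (th z + th w)%R) ->
    (forall z, commute z u -> th z = 0%R -> z = 1) ->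
  infinite_cyclic (centralizer u).
Proof.
move=> u1 thM th0.
have cu1 : commute 1 u by exact/commute_sym/commute1.
have cV z : commute z u -> commute z^-1 u.
  by move=> zu; apply/commute_sym/commuteV.
have cX z n : commute z u -> commute (z ^+ n) u.
  by move=> zu; apply/commute_sym/commuteX.
have cM z w : commute z u -> commute w u -> commute (z * w) u.
  by move=> zu wu; apply/commute_sym/commuteM.
have th1 : th 1 = 0%R by have := thM 1 1 cu1 cu1; rewrite mulg1; lia.
have thV z : commute z u -> th z^-1 = (- th z)%R.
  by move=> zu; have := thM _ _ zu (cV _ zu); rewrite mulgV th1; lia.
have thX z n : commute z u -> th (z ^+ n) = (Posz n * th z)%R.
  move=> zu; elim: n => [|n IH]; first by rewrite expg0 th1; lia.
  by rewrite expgS thM ?IH //; [lia | exact: cX].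
have inj z w : commute z u -> commute w u -> th z = th w -> z = w.
  move=> zu wu zw; apply: divg1_eq; apply: th0; first exact/cM/cV.
  by rewrite thM ?thV //; [lia | exact: cV].
have uu : commute u u by [].
have thu : th u <> 0%R by move=> /th0 e; apply/u1/e.
split.
  apply/infiniteP; have injX : {in [set: nat] &, injective (fun n => u ^+ n)}.
    by move=> m n _ _ /(congr1 th); rewrite !thX //; nia.
  rewrite -(card_le_eql (inj_card_eq injX)); apply: subset_card_le.
  by move=> _ [n _ <-]; apply: cX.
have [|m] := @ex_minnP (fun n =>
    `[< exists2 z, commute z u & (0 < n)%N /\ th z = Posz n >]).
  exists `|th u|%N; apply/asboolP.
  have [s|s] : (0 <= th u)%R \/ (th u < 0)%R by lia.
    by exists u => //; split; lia.
  by exists u^-1; [exact: cV|rewrite thV //; split; lia].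
move=> /asboolP[z zu [m0 thz]] mmin.
exists z; rewrite eqEsubset; split=> w; last first.
  by case=> n [] ->; [exact: cX | exact/cV/cX].
move=> wu; rewrite /centralizer /= in wu.
pose q := (`|th w| %/ m)%N; pose r := (`|th w| %% m)%N.
have qr : `|th w|%N = (q * m + r)%N by exact: divn_eq.
have rm : (r < m)%N by rewrite ltn_mod.
have [v [vu thv]] : exists v, commute v u /\ th v = Posz `|th w|%N.
  have [s|s] : (0 <= th w)%R \/ (th w < 0)%R by lia.
    by exists w; split => //; lia.
  by exists w^-1; split; [exact: cV | rewrite thV //; lia].
have zqu := cX z q zu.
have r0 : r = 0%N.
  have [//|r0] := posnP r; suff : (m <= r)%N by lia.
  apply/mmin/asboolP; exists (v / z ^+ q); first exact/cM/cV.
  by rewrite thM ?thV ?thX //; [split => //; nia | exact: cV].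
exists q; have [s|s] : (0 <= th w)%R \/ (th w < 0)%R by lia.
  by left; apply: inj => //; rewrite thX //; nia.
right; apply: inj => //; first exact: cV.
by rewrite thV // thX //; nia.
Qed.

(** * The vertex groups inside their product *)

Section Multiplicative.
Variables (G H : groupType) (f : {multiplicative G -> H}).

Lemma mult1 : f 1 = 1.
Proof. by apply: (@mulgI _ (f 1)); rewrite -gmulfM !mulg1. Qed.

Lemma multV x : f x^-1 = (f x)^-1.
Proof. by apply/esym/mulg1_eq; rewrite -gmulfM mulgV mult1. Qed.

End Multiplicative.

Section Ambient.
Variable D : decomposed_gg.

(** The vertex groups are handled as subgroups of their direct product, so
    that elements of different vertex groups have one and the same type. *)
Definition ambient : Type := forall s : vertex D, vertex_group s.

HB.instance Definition _ := gen_eqMixin ambient.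
HB.instance Definition _ := gen_choiceMixin ambient.

Definition amb_one : ambient := fun=> 1.
Definition amb_mul (x y : ambient) : ambient := fun s => x s * y s.
Definition amb_inv (x : ambient) : ambient := fun s => (x s)^-1.

Lemma amb_mulA : associative amb_mul.
Proof. by move=> x y z; apply: functional_extensionality_dep => s; apply: mulgA. Qed.
Lemma amb_mul1 : left_id amb_one amb_mul.
Proof. by move=> x; apply: functional_extensionality_dep => s; apply: mul1g. Qed.
Lemma amb_mul1r : right_id amb_one amb_mul.
Proof. by move=> x; apply: functional_extensionality_dep => s; apply: mulg1. Qed.
Lemma amb_mulV : left_inverse amb_one amb_inv amb_mul.
Proof. by move=> x; apply: functional_extensionality_dep => s; apply: mulVg. Qed.
Lemma amb_mulVr : right_inverse amb_one amb_inv amb_mul.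
Proof. by move=> x; apply: functional_extensionality_dep => s; apply: mulgV. Qed.

HB.instance Definition _ := isGroup.Build ambient
  amb_mulA amb_mul1 amb_mul1r amb_mulV amb_mulVr.

Notation pos_edge := {a : edge D | a \in gg_pos D}.

Definition emb s (g : vertex_group s) : ambient := dfwith (fun=> 1) g.

Lemma emb_proj s (g : vertex_group s) : emb g s = g.
Proof. exact: dfwith_in. Qed.

Lemma embM s (g h : vertex_group s) : emb (g * h) = emb g * emb h.
Proof.
apply: functional_extensionality_dep => r.
suff : emb (g * h) r = emb g r * emb h r by [].
rewrite /emb; have [<-|sr] := eqVneq s r; first by rewrite !dfwith_in.
by rewrite !dfwith_out // mul1g.
Qed.

Lemma emb1 s : emb (1 : vertex_group s) = 1.
Proof. by apply: (@mulgI _ (emb (1 : vertex_group s))); rewrite -embM !mulg1. Qed.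

Lemma embV s (g : vertex_group s) : emb g^-1 = (emb g)^-1.
Proof. by apply/esym/mulg1_eq; rewrite -embM mulgV emb1. Qed.

(** The graph of phi_a inside the product, for either orientation of the edge;
    the counterpart of [edge_iso] before it is known that the vertex groups
    embed in the fundamental group. *)
Inductive glue : edge D -> ambient -> ambient -> Prop :=
  | glue_pos a (h : edge_group a) :
      glue (val a) (emb (emb_orig a h)) (emb (emb_term a h))
  | glue_neg a (h : edge_group a) :
      glue (einv (val a)) (emb (emb_term a h)) (emb (emb_orig a h)).

Lemma glueV a x y : glue a x y -> glue (einv a) y x.
Proof. by case=> b h; rewrite ?einvK; constructor. Qed.

Lemma edge_pos (a : edge D) : exists b : pos_edge,
  a = val b \/ a = einv (val b).
Proof.
have := gg_posP a; have [aO _|aO /= bO] := boolP (a \in gg_pos D).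
  by exists (exist _ a aO); left.
by exists (exist _ (einv a) bO); right; rewrite /= einvK.
Qed.

Lemma glue_posP (a : pos_edge) x y : glue (val a) x y ->
  exists h : edge_group a, x = emb (emb_orig a h) /\ y = emb (emb_term a h).
Proof.
move e: {1}(val a) => c g; case: g a e => {c x y} b h a e.
  by have eab := val_inj e; subst b; exists h.
have := gg_posP (val b); rewrite -e.
by have := valP a; have := valP b => /= -> ->.
Qed.

Lemma glueM a x y x' y' : glue a x y -> glue a x' y' -> glue a (x * x') (y * y').
Proof.
have pos (b : pos_edge) z t z' t' :
    glue (val b) z t -> glue (val b) z' t' ->
    glue (val b) (z * z') (t * t').
  move=> /glue_posP[h [-> ->]] /glue_posP[k [-> ->]].
  by rewrite -!embM -!gmulfM; constructor.
have [b [->|->]] := edge_pos a; first exact: pos.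
move=> /glueV g /glueV g'; rewrite !einvK in g g'.
exact/glueV/pos.
Qed.

Lemma glue1 a : glue a 1 1.
Proof.
have pos (b : pos_edge) : glue (val b) 1 1.
  by have := glue_pos (1 : edge_group b); rewrite !mult1 !emb1.
by have [b [->|->]] := edge_pos a; [exact: pos | exact/glueV/pos].
Qed.

Lemma glue_fun a x y y' : glue a x y -> glue a x y' -> y = y'.
Proof.
have emb_inj s (g h : vertex_group s) : emb g = emb h -> g = h.
  by move=> e; rewrite -(emb_proj g) e emb_proj.
have [b [->|->]] := edge_pos a.
  move=> /glue_posP[h [-> ->]] /glue_posP[k [/emb_inj + ->]].
  by move/emb_orig_inj ->.
move=> /glueV g /glueV g'; rewrite !einvK in g g'.
move: g g' => /glue_posP[h [-> ->]] /glue_posP[k [+ /emb_inj]].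
by move=> -> /emb_term_inj ->.
Qed.

Lemma glue_invg a x y : glue a x y -> glue a x^-1 y^-1.
Proof.
have pos (b : pos_edge) z t : glue (val b) z t -> glue (val b) z^-1 t^-1.
  move=> /glue_posP[h [-> ->]].
  by rewrite -!embV -!multV; constructor.
have [b [->|->]] := edge_pos a; first exact: pos.
by move=> /glueV g; rewrite einvK in g; exact/glueV/pos.
Qed.
End Ambient.

(** * Normal forms *)

Section NormalForms.
Variable D : decomposed_gg.
Notation P := (ambient D).
Implicit Types (a b : edge D) (x y g c : P) (l : seq (P * edge D)) (s e : vertex D).

Definition in_dom a x : Prop := exists y, glue a x y.

Definition phi a x : P := xget 1 [set y | glue a x y]%classic.

Lemma phiP a x : in_dom a x -> glue a x (phi a x).
Proof. exact: (@xgetPex P 1 [set y | glue a x y]%classic). Qed.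

Lemma phi_eq a x y : glue a x y -> phi a x = y.
Proof. by move=> axy; apply/esym/(glue_fun axy)/phiP; exists y. Qed.

Lemma domM a x y : in_dom a x -> in_dom a y -> in_dom a (x * y).
Proof. by move=> [x' ?] [y' ?]; exists (x' * y'); apply: glueM. Qed.

Lemma domV a x : in_dom a x -> in_dom a x^-1.
Proof. by move=> [x' ?]; exists x'^-1; apply: glue_invg. Qed.

Lemma phi_dom a x : in_dom a x -> in_dom (einv a) (phi a x).
Proof. by move=> ax; exists x; apply/glueV/phiP. Qed.

Lemma phiM a x y :
  in_dom a x -> in_dom a y -> phi a (x * y) = phi a x * phi a y.
Proof. by move=> ax ay; apply/phi_eq/glueM; apply: phiP. Qed.

Lemma phi1 a : phi a 1 = 1.
Proof. exact/phi_eq/glue1. Qed.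

Lemma dom1 a : in_dom a 1.
Proof. by exists 1; apply: glue1. Qed.

(** A representative of the coset [x * dom]: it depends on [x] through a
    predicate which is the same for all members of the coset.  The coset of
    the identity must be represented by [1], on which the definition of
    reduced lists relies. *)
Definition coset_rep a x : P :=
  if `[< in_dom a x >] then 1 else xget 1 [set y | in_dom a (y^-1 * x)]%classic.

Definition coset_rem a x : P := (coset_rep a x)^-1 * x.

Lemma coset_rem_dom a x : in_dom a (coset_rem a x).
Proof.
rewrite /coset_rem /coset_rep; case: asboolP => [|_]; first by rewrite invg1 mul1g.
apply: (@xgetPex _ 1 [set y | in_dom a (y^-1 * x)]%classic).
by exists x; rewrite /= mulVg; apply: dom1.
Qed.

Lemma coset_rep_rem a x : coset_rep a x * coset_rem a x = x.
Proof. by rewrite /coset_rem mulVKg. Qed.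

Lemma dom_mulr a x c : in_dom a c -> in_dom a (x * c) <-> in_dom a x.
Proof.
move=> ac; split=> [|ax]; last exact: domM.
by move=> /domM/(_ (domV ac)); rewrite mulgK.
Qed.

Lemma coset_rep_mulr a x c : in_dom a c -> coset_rep a (x * c) = coset_rep a x.
Proof.
move=> ac; rewrite /coset_rep (propext (dom_mulr x ac)); case: asboolP => // _.
congr (xget _ _); apply: funext => y /=.
by apply: propext; rewrite mulgA; apply: dom_mulr.
Qed.

Lemma coset_rem_mulr a x c : in_dom a c -> coset_rem a (x * c) = coset_rem a x * c.
Proof. by move=> ac; rewrite /coset_rem coset_rep_mulr // mulgA. Qed.

Lemma coset_rep_dom a x : in_dom a x -> coset_rep a x = 1.
Proof. by move=> ax; rewrite /coset_rep; case: asboolP. Qed.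

Lemma coset_rep_eq1 a x : coset_rep a x = 1 -> in_dom a x.
Proof. by move=> r1; rewrite -(coset_rep_rem a x) r1 mul1g; apply: coset_rem_dom. Qed.

Lemma coset_repK a x : coset_rep a (coset_rep a x) = coset_rep a x.
Proof.
by rewrite -[in RHS](coset_rep_rem a x) coset_rep_mulr //; apply: coset_rem_dom.
Qed.

Lemma coset_rep_inj a g x y : coset_rep a x = x -> coset_rep a y = y ->
  coset_rep a (g * x) = coset_rep a (g * y) -> x = y.
Proof.
move=> rx ry e; rewrite -rx -ry.
have -> : x = y * ((coset_rem a (g * y))^-1 * coset_rem a (g * x)).
  have ey : coset_rep a (g * y) = g * y / coset_rem a (g * y).
    by rewrite -{2}(coset_rep_rem a (g * y)) mulgK.
  by apply: (@mulgI _ g); rewrite -[LHS](coset_rep_rem a) e ey !mulgA.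
rewrite coset_rep_mulr //; apply: domM; last exact: coset_rem_dom.
exact/domV/coset_rem_dom.
Qed.

(** Left multiplication by [g] of the normal form [l] followed by [h]: the
    product [g * x] splits into a coset representative, which stays, and an
    element of the edge group, which is carried through the stable letter by
    phi_a.  [nf_mul g l] is the new list and [nf_carry g l] the factor that
    arrives at the end and multiplies [h]. *)
Fixpoint nf_mul g l :=
  if l is (x, a) :: l' then
    (coset_rep a (g * x), a) :: nf_mul (phi a (coset_rem a (g * x))) l'
  else [::].

Fixpoint nf_carry g l :=
  if l is (x, a) :: l' then nf_carry (phi a (coset_rem a (g * x))) l' else g.

(** The list [(_, a) :: l] does not continue with the inverse of the stable
    letter [a]. *)
Definition no_backtrack a l :=
  if l is (y, b) :: _ then ~~ ((b == einv a) && (y == 1)) else true.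

(** The reduced lists leading from the vertex [s] to the vertex [e]; the
    condition [emb (x s) == x] says that [x] lies in the vertex group at [s]. *)
Fixpoint normal s e l : bool :=
  if l is (x, a) :: l' then
    [&& origin a == s, emb (x s) == x, coset_rep a x == x, no_backtrack a l'
      & normal (terminus a) e l']
  else s == e.

Lemma nf_mulM g h l : nf_mul (g * h) l = nf_mul g (nf_mul h l).
Proof.
elim: l g h => //= -[x a] l IH g h /=.
have hr : g * h * x = g * coset_rep a (h * x) * coset_rem a (h * x).
  by rewrite -!mulgA coset_rep_rem.
have dr := @coset_rem_dom a.
by rewrite hr coset_rep_mulr // coset_rem_mulr // phiM // IH.
Qed.

Lemma nf_carryM g h l :
  nf_carry (g * h) l = nf_carry g (nf_mul h l) * nf_carry h l.
Proof.
elim: l g h => //= -[x a] l IH g h /=.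
have hr : g * h * x = g * coset_rep a (h * x) * coset_rem a (h * x).
  by rewrite -!mulgA coset_rep_rem.
have dr := @coset_rem_dom a.
by rewrite hr coset_rem_mulr // phiM // IH.
Qed.

Lemma nf_mul1 s e l : normal s e l -> nf_mul 1 l = l /\ nf_carry 1 l = 1.
Proof.
elim: l s => //= -[x a] l IH s /= /and5P[_ _ /eqP rx _ /IH[e1 e2]].
by rewrite mul1g rx /coset_rem rx mulVg phi1 e1 e2.
Qed.

Lemma emb_vertex_glue a x y : glue a x y ->
  emb (x (origin a)) = x /\ emb (y (terminus a)) = y.
Proof. by case=> b h; rewrite ?terminus_einv !emb_proj. Qed.

Lemma in_vertexM s x y :
  emb (x s) = x -> emb (y s) = y -> emb ((x * y) s) = x * y.
Proof. by move=> ex ey; rewrite -[in RHS]ex -[in RHS]ey -embM. Qed.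

Lemma in_vertexV s x : emb (x s) = x -> emb (x^-1 s) = x^-1.
Proof. by move=> ex; rewrite -[in RHS]ex -embV. Qed.

Lemma coset_rep_vertex a x : emb (x (origin a)) = x ->
  emb (coset_rep a x (origin a)) = coset_rep a x.
Proof.
move=> vx; have -> : coset_rep a x = x * (coset_rem a x)^-1.
  by rewrite -{2}(coset_rep_rem a x) mulgK.
apply: in_vertexM => //; apply: in_vertexV.
by have [] := emb_vertex_glue (phiP (coset_rem_dom a x)).
Qed.

(** Here [g] comes out of the edge group of [a], so that it can make the first
    coset trivial only if this coset was trivial already. *)
Lemma no_backtrack_mul a g s e l :
  in_dom (einv a) g -> normal s e l -> no_backtrack a l ->
  no_backtrack a (nf_mul g l).
Proof.
case: l => //= -[y b] l ag /= /and5P[_ _ /eqP ry _ _].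
apply: contraNN => /andP[/eqP eb /eqP r1]; rewrite {}eb eqxx /= in ry r1 *.
move/coset_rep_eq1: r1 => /(domM (domV ag)); rewrite mulKg => /coset_rep_dom.
by rewrite ry => ->.
Qed.

Lemma normal_mul g s e l :
  emb (g s) = g -> normal s e l -> normal s e (nf_mul g l).
Proof.
elim: l g s => //= -[x a] l IH g s vg /= /and5P[/eqP oa /eqP vx /eqP rx hl nl].
have dr := @coset_rem_dom a.
rewrite oa eqxx coset_repK eqxx /=; apply/and3P; split.
- by subst s; apply/eqP/coset_rep_vertex/in_vertexM.
- exact: no_backtrack_mul (phi_dom _) nl hl.
- by apply: IH nl; have [] := emb_vertex_glue (phiP (dr (g * x))).
Qed.

(** [g] permutes cosets, so that two lists part after [g] has acted where they
    parted before, and up to there the carried elements are the same. *)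
Lemma lcp_mul g s e1 e2 l1 l2 : normal s e1 l1 -> normal s e2 l2 ->
  lcp (nf_mul g l1) (nf_mul g l2) = lcp l1 l2.
Proof.
elim: l1 l2 g s => [|[x a] l1 IH] [|[y b] l2] g s //=.
move=> /and5P[_ _ /eqP rx _ n1] /and5P[_ _ /eqP ry _ n2].
rewrite !xpair_eqE; have [eab|] := eqVneq a b; last by rewrite !andbF.
subst b; rewrite !andbT; have [exy|nxy] := eqVneq x y.
  by subst y; rewrite eqxx (IH _ _ (terminus a)).
by case: eqP => // /(coset_rep_inj rx ry) /eqP; rewrite (negPf nxy).
Qed.

Lemma size_mul g l : size (nf_mul g l) = size l.
Proof. by elim: l g => //= -[x a] l IH g /=; rewrite IH. Qed.

(** Left multiplication by the stable letter of [a], with cancellation. *)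
Definition nf_stable a l :=
  if l is (y, b) :: l' then
    if (b == einv a) && (y == 1) then l' else (1, a) :: l
  else [:: (1, a)].

Lemma nf_stable_cons a l : no_backtrack a l -> nf_stable a l = (1, a) :: l.
Proof. by case: l => [|[y b] l] //= /negPf ->. Qed.

Lemma normal_stable a e l :
  normal (terminus a) e l -> normal (origin a) e (nf_stable a l).
Proof.
have n1 l' : no_backtrack a l' -> normal (terminus a) e l' ->
    normal (origin a) e ((1, a) :: l').
  move=> h n; rewrite /= eqxx h n (emb1 (origin a)) coset_rep_dom ?eqxx //.
  exact: dom1.
case: l => [|[y b] l] nl; first exact: n1.
rewrite /nf_stable; case: ifP => [/andP[/eqP eb _]|hb].
  by move: nl => /= /and5P[_ _ _ _]; rewrite eb terminus_einv.
by apply: n1 => //; rewrite /= hb.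
Qed.

Lemma nf_stableK a e l : normal (terminus a) e l ->
  nf_stable (einv a) (nf_stable a l) = l.
Proof.
case: l => [|[y b] l] nl; first by rewrite /= einvK !eqxx.
rewrite /=; case: ifP => [/andP[/eqP eb /eqP ey]|hb]; last first.
  by rewrite /= einvK !eqxx.
subst b y; move: nl => /= /and5P[_ _ _ hl _].
by case: l hl => [|[z c] l] //= /negPf ->.
Qed.

(** The defining relation of the stable letter of [a], [x = t y t^-1], holds
    for the action on normal forms. *)
Lemma nf_stable_glue a x y e l : glue a x y -> normal (terminus a) e l ->
  nf_mul x (nf_stable a l) = nf_stable a (nf_mul y l) /\
  nf_carry x (nf_stable a l) = nf_carry y l.
Proof.
move=> axy nl.
have far : no_backtrack a l ->
    nf_mul x ((1, a) :: l) = (1, a) :: nf_mul y l /\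
    nf_carry x ((1, a) :: l) = nf_carry y l.
  move=> hl; rewrite /= mulg1 coset_rep_dom; last by exists y.
  by rewrite /coset_rem coset_rep_dom ?invg1 ?mul1g ?(phi_eq axy) //; exists y.
have ay : in_dom (einv a) y by exists x; apply: glueV.
have [hl|] := boolP (no_backtrack a l).
  by have [e1 e2] := far hl; rewrite !nf_stable_cons // (no_backtrack_mul ay nl).
case: l nl {far} => [|[z c] l] //= nl; rewrite negbK => /andP[/eqP ec /eqP ez].
subst c z; rewrite !eqxx mulg1 /coset_rem coset_rep_dom // eqxx invg1 mul1g.
by rewrite (phi_eq (glueV axy)).
Qed.

(** Only the case in which exactly one of the two lists undergoes a
    cancellation is in question; the common prefix is then empty before and
    after. *)
Lemma prefix_dist_stable a e1 e2 l1 l2 :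
  normal (terminus a) e1 l1 -> normal (terminus a) e2 l2 ->
  prefix_dist (nf_stable a l1) (nf_stable a l2) = prefix_dist l1 l2.
Proof.
have stable_near l' : ~~ no_backtrack a l' ->
    exists2 l : seq (P * edge D), l' = (1 : P, einv a) :: l & nf_stable a l' = l.
  case: l' => [|[z c] l'] //=; rewrite negbK => h; rewrite h.
  by move/andP: h => [/eqP -> /eqP ->]; exists l'.
have mixed f1 f2 k1 k2 :
    normal (terminus a) f1 k1 -> normal (terminus a) f2 k2 ->
    no_backtrack a k1 -> ~~ no_backtrack a k2 ->
    prefix_dist (nf_stable a k1) (nf_stable a k2) = prefix_dist k1 k2.
  move=> n1 n2 h1 /stable_near[k ek ->]; rewrite (nf_stable_cons h1).
  have hk : no_backtrack (einv a) k by move: n2; rewrite ek /= => /and5P[].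
  have l0 : lcp k1 k2 = 0%N.
    case: k1 h1 {n1} => [|[z c] k1] //=; rewrite ek xpair_eqE.
    by rewrite andbC => /negPf ->.
  have l0' : lcp ((1, a) :: k1) k = 0%N.
    case: (k) hk => [|[z c] k'] //=; rewrite einvK xpair_eqE.
    by rewrite andbC (eq_sym c) (eq_sym z) => /negPf ->.
  rewrite /prefix_dist l0 l0' ek /=; lia.
move=> n1 n2; have [h1|h1] := boolP (no_backtrack a l1); last first.
  have [h2|h2] := boolP (no_backtrack a l2).
    by rewrite prefix_distC (mixed _ _ _ _ n2 n1) // prefix_distC.
  have [k1 -> ->] := stable_near _ h1; have [k2 -> ->] := stable_near _ h2.
  by rewrite prefix_dist_cons.
have [h2|h2] := boolP (no_backtrack a l2); last exact: mixed n1 n2 h1 h2.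
by rewrite !nf_stable_cons // prefix_dist_cons.
Qed.

Definition edge_sign a : int := if a \in gg_pos D then 1%R else (-1)%R.

Lemma edge_sign_einv a : edge_sign (einv a) = (- edge_sign a)%R.
Proof.
by rewrite /edge_sign; have := gg_posP a; do 2 case: (_ \in _).
Qed.

Fixpoint exponent_sum l : int :=
  if l is (_, a) :: l' then (edge_sign a + exponent_sum l')%R else 0%R.

Lemma exponent_sum_mul g l : exponent_sum (nf_mul g l) = exponent_sum l.
Proof. by elim: l g => //= -[x a] l IH g /=; rewrite IH. Qed.

Lemma exponent_sum_stable a l :
  exponent_sum (nf_stable a l) = (edge_sign a + exponent_sum l)%R.
Proof.
case: l => [|[y b] l] //=; case: ifP => // /andP[/eqP -> _].
by rewrite edge_sign_einv; lia.
Qed.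

(** Neighbours in the tree are joined by one edge, positive or negative. *)
Lemma exponent_sum_step l1 l2 :
  prefix_dist l1 l2 = 1%N -> exponent_sum l1 <> exponent_sum l2.
Proof.
have nz a : edge_sign a <> 0%R by rewrite /edge_sign; case: ifP.
elim: l1 l2 => [|[x a] l1 IH] [|[y b] l2].
- by rewrite prefix_dist_refl.
- by case: l2 => //= _; have := nz b; lia.
- by case: l1 {IH} => //= _; have := nz a; lia.
have [[<- <-]|ne] := eqVneq (x, a) (y, b).
  by rewrite prefix_dist_cons => /IH /=; lia.
by rewrite /prefix_dist /= (negPf ne); lia.
Qed.

Lemma normal_take k s e l : normal s e l -> exists e', normal s e' (take k l).
Proof.
elim: l s k => [|[x a] l IH] s [|k] /=; try by exists s.
move=> /and5P[-> -> -> hl /IH-/(_ k)[e' n]]; exists e'; rewrite n /= andbT.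
by case: l hl {IH n} => [|[y b] l] //; case: k.
Qed.

End NormalForms.

(** * The action of words on normal forms *)

Section Words.
Variable D : decomposed_gg.
Notation pos_edge := {a : edge D | a \in gg_pos D}.
Notation P := (ambient D).
Notation state := (seq (P * edge D) * P)%type.
Implicit Types (a b : edge D) (s t r e : vertex D) (om : state).

(** Words in the fundamental groupoid of the graph of groups: a letter leads
    from the vertex [lsrc] to the vertex [ltgt] and maps normal forms based at
    [ltgt] to normal forms based at [lsrc]. *)
Inductive letter :=
  | LVert s (g : vertex_group s)
  | LEdge a.

Implicit Types (k : letter) (w v : seq letter).

Definition lsrc k := match k with LVert s _ => s | LEdge a => origin a end.
Definition ltgt k := match k with LVert s _ => s | LEdge a => terminus a end.
Definition linv k :=
  match k with LVert s g => LVert g^-1 | LEdge a => LEdge (einv a) end.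

Definition lact k om : state :=
  match k with
  | LVert s g => (nf_mul (emb g) om.1, nf_carry (emb g) om.1 * om.2)
  | LEdge a => (nf_stable a om.1, om.2)
  end.

Lemma linvK : involutive linv.
Proof. by case=> [s g|a] /=; rewrite ?invgK ?einvK. Qed.

Lemma lsrc_inv k : lsrc (linv k) = ltgt k.
Proof. by case: k. Qed.

Lemma ltgt_inv k : ltgt (linv k) = lsrc k.
Proof. by case: k => //= a; rewrite terminus_einv. Qed.

Lemma normal_lact k e om :
  normal (ltgt k) e om.1 -> normal (lsrc k) e (lact k om).1.
Proof.
case: k => [s g|a] /= n; last exact: normal_stable.
by apply: normal_mul => //; rewrite emb_proj.
Qed.

Lemma lactK k e om : normal (ltgt k) e om.1 -> lact (linv k) (lact k om) = om.
Proof.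
case: om => l h; case: k => [s g|a] /= n; last by rewrite (nf_stableK n).
have [e1 e2] := nf_mul1 n.
by rewrite mulgA -nf_mulM -nf_carryM embV mulVg e1 e2 mul1g.
Qed.

Fixpoint wtyped s t w : bool :=
  if w is k :: w' then (lsrc k == s) && wtyped (ltgt k) t w' else s == t.

Definition winv w := rev (map linv w).
Fixpoint wact w om := if w is k :: w' then lact k (wact w' om) else om.

Lemma winv_cons k w : winv (k :: w) = rcons (winv w) (linv k).
Proof. by rewrite /winv /= rev_cons. Qed.

Lemma winvK : involutive winv.
Proof. by move=> w; rewrite /winv map_rev revK (mapK linvK). Qed.

Lemma winv_cat w v : winv (w ++ v) = winv v ++ winv w.
Proof. by rewrite /winv map_cat rev_cat. Qed.

Lemma wact_cat w v om : wact (w ++ v) om = wact w (wact v om).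
Proof. by elim: w => //= k w ->. Qed.

Lemma wact_cons k w om : wact (k :: w) om = lact k (wact w om).
Proof. by []. Qed.

Lemma wtyped_cat s r t w v : wtyped s r w -> wtyped r t v -> wtyped s t (w ++ v).
Proof.
elim: w s => /= [|k w IH] s; first by move/eqP->.
by case/andP=> -> wt vt; rewrite IH.
Qed.

Lemma wtyped_inv s t w : wtyped s t w -> wtyped t s (winv w).
Proof.
elim: w s => /= [|k w IH] s; first by rewrite eq_sym.
case/andP=> /eqP <- wt; rewrite winv_cons -cats1.
by apply: wtyped_cat (IH _ wt) _; rewrite /= lsrc_inv ltgt_inv !eqxx.
Qed.

Lemma normal_wact s t e w om : wtyped s t w -> normal t e om.1 ->
  normal s e (wact w om).1.
Proof.
elim: w s => /= [|k w IH] s; first by move/eqP->.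
by case/andP=> /eqP <- wt n; apply/normal_lact/IH.
Qed.

Lemma wactK s t e w om : wtyped s t w -> normal t e om.1 ->
  wact (winv w) (wact w om) = om.
Proof.
elim: w s => //= k w IH s /andP[_ wt] n.
rewrite winv_cons -cats1 wact_cat /= (lactK (e := e)); first exact: IH wt n.
exact: normal_wact wt n.
Qed.

Lemma wactVK s t e w om : wtyped s t w -> normal s e om.1 ->
  wact w (wact (winv w) om) = om.
Proof. by move=> /wtyped_inv wt n; rewrite -{1}(winvK w) (wactK wt n). Qed.

Lemma prefix_dist_wact s t e1 e2 w om1 om2 : wtyped s t w ->
  normal t e1 om1.1 -> normal t e2 om2.1 ->
  prefix_dist (wact w om1).1 (wact w om2).1 = prefix_dist om1.1 om2.1.
Proof.
move=> wt n1 n2; elim: w s wt => //= k w IH s /andP[_ wt].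
rewrite -(IH _ wt); have := normal_wact wt n1; have := normal_wact wt n2.
move: (wact w om1) (wact w om2) => [l1 h1] [l2 h2] {IH wt n1 n2} /=.
case: k => [r g|a] /= n2 n1; last exact: prefix_dist_stable n1 n2.
by rewrite /prefix_dist !size_mul (lcp_mul _ n1 n2).
Qed.

Fixpoint word_exponent_sum w : int :=
  match w with
  | [::] => 0%R
  | LVert _ _ :: w' => word_exponent_sum w'
  | LEdge a :: w' => (edge_sign a + word_exponent_sum w')%R
  end.

Lemma exponent_sum_wact w om :
  exponent_sum (wact w om).1 = (word_exponent_sum w + exponent_sum om.1)%R.
Proof.
elim: w => [|[s g|a] w IH] /=; first by rewrite GRing.add0r.
  by rewrite exponent_sum_mul.
by rewrite exponent_sum_stable IH GRing.addrA.
Qed.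

Definition epath (p : seq (edge D)) := map LEdge p.

Lemma wtyped_epath (E : {set edge D}) s t p : walk E s t p -> wtyped s t (epath p).
Proof. by elim: p s => //= a p IH s /and3P[_ -> /IH]. Qed.

(** A closed walk in the tree is empty or backtracks, and a backtracking acts
    trivially. *)
Lemma closed_walk_act s e p om : walk (tree_edge D) s s p -> normal s e om.1 ->
  wact (epath p) om = om.
Proof.
have [[_ _ _ acyc] _] := @tree_maximal D.
have [n] := ubnP (size p); elim: n p => // n IH p lt w nf.
have [red|] := boolP (reduced_path p); first by rewrite (acyc _ _ w red).
case/not_reduced => p1 [b [p2 ep]]; rewrite {}ep in lt w *.
have [r w1 /= /and5P[bE /eqP ob _ _ w2]] := walk_catP w.
rewrite terminus_einv ob in w2.
rewrite /epath map_cat wact_cat /= -/(epath p2).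
have n2 := normal_wact (wtyped_epath w2) nf.
have := @lactK (LEdge (einv b)) e (wact (epath p2) om); rewrite /= einvK.
rewrite terminus_einv ob => /(_ n2) /= ->.
rewrite -/(epath p1) -wact_cat -map_cat; apply: IH => //.
  by move: lt; rewrite !size_cat /=; lia.
exact: walk_cat w1 w2.
Qed.

Lemma tree_walk s t : exists p, walk (tree_edge D) s t p.
Proof.
have := @maximal_tree_spans _ _ _ (@gg_connected D) (@tree_maximal D).
by have [[_ _ conn _] _] := @tree_maximal D => spans; apply: conn.
Qed.

Section Base.
Variable s0 : vertex D.

(** Stable letters of the tree are trivial in [pi1 D], so that a generator may
    be conjugated by tree paths into a word that is closed at [s0]. *)
Definition tpath s : seq letter :=
  epath (xget [::] [set p | walk (tree_edge D) s0 s p]%classic).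

Lemma tpathP s : exists2 p, walk (tree_edge D) s0 s p & tpath s = epath p.
Proof.
exists (xget [::] [set p | walk (tree_edge D) s0 s p]%classic) => //.
exact: (@xgetPex _ [::]
  [set p | walk (tree_edge D) s0 s p]%classic (tree_walk s0 s)).
Qed.

Lemma tpath_typed s : wtyped s0 s (tpath s).
Proof. by have [p w ->] := tpathP s; apply: wtyped_epath w. Qed.

Fixpoint word (x : expr D) : seq letter :=
  match x with
  | EVert s g => tpath s ++ LVert g :: winv (tpath s)
  | EStable a => tpath (origin a) ++ LEdge a :: winv (tpath (terminus a))
  | EOne => [::]
  | EMul x y => word x ++ word y
  | EInv x => winv (word x)
  end.

Lemma word_typed x : wtyped s0 s0 (word x).
Proof.
elim: x => //= [s g|a|x IHx y IHy|x IH].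
- by apply: wtyped_cat (tpath_typed s) _; rewrite /= eqxx wtyped_inv // tpath_typed.
- apply: wtyped_cat (tpath_typed _) _.
  by rewrite /= eqxx wtyped_inv // tpath_typed.
- exact: wtyped_cat IHx IHy.
- exact: wtyped_inv.
Qed.

Lemma lact_rel (b : pos_edge) (h : edge_group b) e om :
    normal (origin (val b)) e om.1 ->
  lact (LVert (emb_orig b h)) om =
  lact (LEdge (val b))
    (lact (LVert (emb_term b h)) (lact (LEdge (einv (val b))) om)).
Proof.
move=> n; rewrite -terminus_einv in n.
have n' := @normal_lact (LEdge (einv (val b))) e om n.
have := @lactK (LEdge (einv (val b))) e om n.
case: om n n' => l c n n' /=; rewrite einvK => -[el].
have [e1 e2] := nf_stable_glue (glue_pos h) n'.
by rewrite -e1 -e2 el.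
Qed.

(** Van der Waerden's trick: every defining relation of [pi1 D] holds for the
    action on normal forms, so [pi1 D] acts on them. *)
Lemma word_eq x y : expr_eq x y -> forall e om, normal s0 e om.1 ->
  wact (word x) om = wact (word y) om.
Proof.
elim=> {x y}.
- by [].
- by move=> x y _ IH e om n; rewrite (IH e).
- by move=> x y z _ IH1 _ IH2 e om n; rewrite (IH1 e) // (IH2 e).
- move=> x x' y y' _ IHx _ IHy e om n /=.
  rewrite !wact_cat (IHy e) //; apply: (IHx e).
  exact: normal_wact (word_typed _) n.
- move=> x x' _ IH e om n /=.
  have n' := normal_wact (wtyped_inv (word_typed x')) n.
  have := IH e _ n'; rewrite (wactVK (word_typed x') n) => {1}<-.
  by rewrite (wactK (word_typed x) n').
- by move=> x y z e om n /=; rewrite catA.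
- by [].
- by move=> x e om n /=; rewrite wact_cat (wactK (word_typed x) n).
- move=> s g h e om n.
  rewrite [word _]/= [word (EMul _ _)]/= !(wact_cat, wact_cons).
  have n1 := normal_wact (wtyped_inv (tpath_typed s)) n.
  set om1 := wact _ om in n1 *.
  have n2 := @normal_lact (LVert h) e om1 n1.
  rewrite (wactK (tpath_typed s) n2) /=.
  by rewrite embM nf_mulM nf_carryM mulgA.
- move=> b h e om n.
  rewrite [word _]/= [word (EMul _ _)]/= winv_cat winv_cons winvK -cats1.
  rewrite !(wact_cat, wact_cons) [linv _]/=.
  have n1 := normal_wact (wtyped_inv (tpath_typed (origin (val b)))) n.
  set om1 := wact _ om in n1 *.
  have n2 : normal (terminus (val b)) e (lact (LEdge (einv (val b))) om1).1.
    by apply: normal_lact; rewrite /= terminus_einv.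
  rewrite (wactK (tpath_typed _) n2).
  have n3 := @normal_lact (LVert (emb_term b h)) e _ n2.
  by rewrite (wactK (tpath_typed _) n3) -(lact_rel h n1).
- move=> a e om n.
  by rewrite /= winv_cat winv_cons winvK cat_rcons terminus_einv.
- move=> a aE e om n; rewrite [word _]/= !(wact_cat, wact_cons).
  have [p wp ep] := tpathP (origin a); have [q wq eq] := tpathP (terminus a).
  have wap : walk (tree_edge D) s0 (terminus a) (p ++ [:: a]).
    by apply: walk_cat wp _; rewrite /= aE !eqxx.
  have nq := normal_wact (wtyped_inv (wtyped_epath wq)) n.
  rewrite ep eq; set om1 := wact (winv _) om in nq *.
  have [[sub _ _ _] _] := @tree_maximal D.
  have wq' := walk_inv sub wq.
  have := closed_walk_act (walk_cat wap wq') n.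
  rewrite /epath !map_cat !(wact_cat, wact_cons) /om1 /path_inv map_rev.
  rewrite /winv -!map_comp.
  exact.
Qed.
End Base.
End Words.

(** * Evaluation in the fundamental group, and circuits *)

Section Evaluation.
Variable D : decomposed_gg.
Notation P := (ambient D).
Notation state := (seq (P * edge D) * P)%type.
Notation pos_edge := {a : edge D | a \in gg_pos D}.
Implicit Types (a b : edge D) (s t r e : vertex D) (om : state) (x y g h : P)
  (l : seq (P * edge D)) (k : letter D) (w v : seq (letter D)) (u z : pi1 D).

Lemma iotaM s (g h : vertex_group s) :
  iota_vert (g * h) = iota_vert g * iota_vert h.
Proof.
by rewrite /iota_vert [RHS]pi1_mulE; apply/pi1_classP; apply: expr_vert.
Qed.

Definition ev s x : pi1 D := iota_vert (x s).

Lemma evM s x y : ev s (x * y) = ev s x * ev s y.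
Proof. exact: iotaM. Qed.

Lemma ev1 s : ev s 1 = 1.
Proof. by apply: (@mulgI _ (ev s 1)); rewrite -evM !mulg1. Qed.

Definition stable a : pi1 D := pi1_class (EStable a).

Lemma stable_einv a : stable (einv a) = (stable a)^-1.
Proof. by rewrite [RHS]pi1_invE; apply/pi1_classP; apply: expr_stableV. Qed.

Lemma ev_glue a x y : glue a x y ->
  ev (origin a) x = stable a * ev (terminus a) y / stable a.
Proof.
have pos (b : pos_edge) (h : edge_group b) : iota_vert (emb_orig b h) =
    stable (val b) * iota_vert (emb_term b h) / stable (val b).
  rewrite [(stable _)^-1]pi1_invE [_ * iota_vert _]pi1_mulE [RHS]pi1_mulE.
  by apply/pi1_classP; apply: expr_edge.
case=> b h; first by rewrite /ev !emb_proj pos.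
rewrite stable_einv terminus_einv /ev !emb_proj pos.
by rewrite invgK !mulgA mulVg mul1g mulgVK.
Qed.

Lemma edge_iso_ev a x y : glue a x y ->
  edge_iso a (ev (origin a) x) (ev (terminus a) y).
Proof.
case=> b h; first by rewrite /ev !emb_proj; constructor.
by rewrite terminus_einv /ev !emb_proj; constructor.
Qed.

Lemma edge_iso_glue a u z : edge_iso a u z ->
  exists x y, glue a x y /\ z = ev (terminus a) y.
Proof.
case=> b h.
  exists (emb (emb_orig b h)), (emb (emb_term b h)).
  by rewrite /ev emb_proj; split; first constructor.
exists (emb (emb_term b h)), (emb (emb_orig b h)).
by rewrite terminus_einv /ev emb_proj; split; first constructor.
Qed.

Fixpoint nf_eval l : pi1 D :=
  if l is (x, a) :: l' then ev (origin a) x * stable a * nf_eval l' else 1.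

Definition eval e om : pi1 D := nf_eval om.1 * ev e om.2.

Definition letter_eval k : pi1 D :=
  match k with LVert s g => iota_vert g | LEdge a => stable a end.

Fixpoint word_eval w : pi1 D :=
  if w is k :: w' then letter_eval k * word_eval w' else 1.

(** The edge group elements created by [nf_mul] telescope. *)
Lemma nf_eval_mul s e g l : normal s e l ->
  nf_eval (nf_mul g l) * ev e (nf_carry g l) = ev s g * nf_eval l.
Proof.
elim: l g s => [|[x a] l IH] g s /=; first by move/eqP->; rewrite mul1g mulg1.
move=> /and5P[/eqP <- _ _ _ n].
rewrite -mulgA (IH _ _ n) !mulgA; congr (_ * _).
rewrite -evM -[in RHS](coset_rep_rem a (g * x)) evM.
by rewrite (ev_glue (phiP (coset_rem_dom a (g * x)))) !mulgA mulgVK.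
Qed.

Lemma nf_eval_stable a l : nf_eval (nf_stable a l) = stable a * nf_eval l.
Proof.
case: l => [|[y b] l] /=; first by rewrite ev1 mul1g.
case: ifP => [/andP[/eqP -> /eqP ->]|_] /=; last by rewrite ev1 mul1g.
by rewrite stable_einv ev1 mul1g mulVKg.
Qed.

Lemma eval_lact k e om : normal (ltgt k) e om.1 ->
  eval e (lact k om) = letter_eval k * eval e om.
Proof.
case: om => l h; case: k => [s g|a] /= n; last by rewrite /eval nf_eval_stable mulgA.
by rewrite /eval /= evM mulgA (nf_eval_mul _ n) /ev emb_proj mulgA.
Qed.

Lemma eval_wact s t e w om : wtyped s t w -> normal t e om.1 ->
  eval e (wact w om) = word_eval w * eval e om.
Proof.
move=> wt n; elim: w s wt => [|k w IH] s /=; first by rewrite mul1g.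
case/andP=> _ wt; rewrite eval_lact ?(IH _ wt) ?mulgA //.
exact: normal_wact wt n.
Qed.

Lemma word_eval_cat w v : word_eval (w ++ v) = word_eval w * word_eval v.
Proof. by elim: w => [|k w IH] /=; rewrite ?mul1g // IH mulgA. Qed.

Lemma letter_eval_inv k : letter_eval (linv k) = (letter_eval k)^-1.
Proof.
case: k => [s g|a] /=; last exact: stable_einv.
apply/esym/mulg1_eq; rewrite -iotaM mulgV.
by have := ev1 s.
Qed.

Lemma word_eval_inv w : word_eval (winv w) = (word_eval w)^-1.
Proof.
elim: w => [|k w IH]; first by rewrite /winv /= invg1.
by rewrite winv_cons -cats1 word_eval_cat /= letter_eval_inv IH mulg1 invgM.
Qed.

Lemma word_eval_tpath s0 s : word_eval (tpath s0 s) = 1.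
Proof.
have [p + ->] := tpathP s0 s; elim: p s0 => //= a p IH r /and3P[aE _ /IH ->].
by rewrite mulg1; apply/pi1_classP; apply: expr_tree.
Qed.

Lemma word_eval_word s0 (x : expr D) : word_eval (word s0 x) = pi1_class x.
Proof.
elim: x => //= [s g|a|x IHx y IHy|x IH].
- by rewrite word_eval_cat /= word_eval_inv !word_eval_tpath invg1 mulg1 mul1g.
- by rewrite word_eval_cat /= word_eval_inv !word_eval_tpath invg1 mulg1 mul1g.
- by rewrite word_eval_cat IHx IHy; apply: pi1_mulE.
- by rewrite word_eval_inv IH; apply: pi1_invE.
Qed.

Lemma word_vert s0 (g : vertex_group s0) e om : normal s0 e om.1 ->
  wact (word s0 (EVert g)) om = lact (LVert g) om.
Proof.
have trivial_tpath om' : normal s0 e om'.1 -> wact (tpath s0 s0) om' = om'.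
  by have [p w ->] := tpathP s0 s0; apply: closed_walk_act.
move=> n; rewrite wact_cat wact_cons.
have -> : wact (winv (tpath s0 s0)) om = om.
  by rewrite -{1}(trivial_tpath _ n) (wactK (tpath_typed s0 s0) n).
exact/trivial_tpath/(@normal_lact _ (LVert g)).
Qed.

(** The vertex group at [s] acts freely on the normal forms with empty list. *)
Lemma iota_inj s : injective (@iota_vert D s).
Proof.
move=> g h /pi1_classP/(@word_eq _ s)/(_ s ([::], 1) (eqxx s)).
rewrite !(@word_vert s _ s) //= => -[]; rewrite !mulg1 => e.
by rewrite -(emb_proj g) e emb_proj.
Qed.

(** The element that follows the current position of the normal form
    [(l, h)]: it is [h_i] in the circuit along [l]. *)
Definition next_elt e l h : pi1 D :=
  if l is (x, a) :: _ then ev (origin a) x else ev e h.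

(** If [g] fixes [l] then [c], carried along [l], is the edge group element
    c_i^- at each step and [phi a c] is c_i^+. *)
Fixpoint circuit_steps e g l h : seq (step D) :=
  if l is (x, a) :: l' then
    let c := coset_rem a (g * x) in
    Step a (ev (origin a) c) (ev (terminus a) (phi a c)) (next_elt e l' h)
      :: circuit_steps e (phi a c) l' h
  else [::].

(** The equations of a circuit express that [g] fixes the path [l]; the last
    one, at the end of the path, is the commutation with [u]. *)
Lemma circuit_of_fixed_path u s e g l h : normal s e l -> nf_mul g l = l ->
    ev s g * eval e (l, h) = eval e (l, h) * u ->
  circuit_from u e s (ev s g) (next_elt e l h) (circuit_steps e g l h).
Proof.
elim: l g s => [|[x a] l IH] g s.
  move=> /= /eqP <- _; rewrite /eval /= mul1g => eq; split; first by exists (h s).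
  by split=> //; rewrite -eq mulgK.
rewrite [normal _ _ _]/= => /and5P[/eqP <- _ _ _ n] /= [rx fl].
have gx : g * x = x * coset_rem a (g * x).
  by rewrite -{1}(coset_rep_rem a (g * x)) rx.
set c := coset_rem a (g * x) in gx fl *.
have ac : in_dom a c := coset_rem_dom _ _.
rewrite /eval /= => eq; split; first by exists (x (origin a)).
split=> //.
- exact/edge_iso_ev/phiP.
- by rewrite -evM -gx evM mulgK.
apply: IH => //; rewrite /eval /=.
apply: (@mulgI _ (ev (origin a) x * stable a)).
rewrite !mulgA in eq *; rewrite -eq -evM gx evM.
by rewrite (ev_glue (phiP ac)) !mulgA mulgVK.
Qed.

(** In a normal form, an element that lies in the edge group at a backtracking
    is the representative of the trivial coset, hence [1], which is excluded.
    The injectivity of the vertex groups brings this back from [pi1 D]. *)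
Lemma circuit_steps_reduced s e g l h :
  normal s e l -> reduced_circuit (circuit_steps e g l h).
Proof.
elim: l g s => [|[x a] l IH] g s; first by move=> _ [|? []].
rewrite /= => /and5P[_ _ _ hl n] [|st0 p1] st st' p2; last first.
  by case=> _ /(IH _ _ n).
case: l hl n {IH} => [|[y b] l] //= + /and5P[/eqP ob /eqP vy /eqP ry _ _].
move=> hl [<- <- _] /= [eb [z /edge_iso_glue[x' [y' [gl]]]]].
rewrite ob => /iota_inj eyy; case/negP: hl; rewrite eb eqxx /=.
have [_ vy'] := emb_vertex_glue gl.
have yy : y = y' by rewrite -vy -vy' eyy.
by rewrite -ry eb coset_rep_dom // yy; exists x'; apply: glueV.
Qed.

(** With [s] as base vertex, [z] moves the trivial normal form to one that has
    the value [z], and the list of the latter is fixed by [u] as [u] commutes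
    with [z]; it gives a reduced circuit at [u] unless it is empty. *)
Lemma centralizer_vertex s u z : without_circuit D -> u <> 1 ->
  vertex_subgroup s u -> commute z u -> vertex_subgroup s z.
Proof.
move=> noc u1 uv zu; have us := uv; case: uv => g _ eu.
pose om0 : state := ([::], 1); have n0 : normal s s om0.1 by rewrite /= eqxx.
pose x := pi1_repr z; have ez : z = pi1_class x by rewrite pi1_reprK.
pose om := wact (word s x) om0.
have n : normal s s om.1 := normal_wact (word_typed s x) n0.
have ezv : eval s om = z.
  by rewrite (eval_wact (word_typed s x) n0) word_eval_word -ez /eval ev1 !mulg1.
have fixl : nf_mul (emb g) om.1 = om.1.
  have ng := @normal_lact _ (LVert g) s om0 n0.
  have eqe : expr_eq (EMul (EVert g) x) (EMul x (EVert g)).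
    by apply/pi1_classP; move: zu; rewrite -eu ez => zu; rewrite -!pi1_mulE.
  have wordM (x1 x2 : expr D) : word s (EMul x1 x2) = word s x1 ++ word s x2 by [].
  have := word_eq eqe n0; rewrite !wordM.
  rewrite (wact_cat (word s (EVert g))) (wact_cat (word s x)).
  rewrite !(@word_vert s _ s) // -/om => /(congr1 fst) /= ->.
  apply/prefix_dist_eq0.
  by rewrite (prefix_dist_wact (word_typed s x) ng n0) prefix_dist_refl.
have circ : is_circuit u s (next_elt s om.1 om.2)
    (circuit_steps s (emb g) om.1 om.2).
  split=> //; have eg : ev s (emb g) = u by rewrite /ev emb_proj.
  rewrite -{2}eg; apply: circuit_of_fixed_path => //; rewrite eg.
  by rewrite -surjective_pairing ezv.
have := noc _ _ _ _ u1 circ (@circuit_steps_reduced s s (emb g) om.1 om.2 n).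
move: ezv; case: om {n fixl circ} => -[|[y a] l] h //= <- _.
by rewrite /eval mul1g; exists (h s).
Qed.

End Evaluation.

(** * The action on the tree, and the theorem *)

Section Action.
Variables (D : decomposed_gg) (s0 : vertex D).
Notation state := (seq (ambient D * edge D) * ambient D)%type.
Implicit Types (u z : pi1 D).

(** Normal forms with the same list are the same vertex of the tree, at
    distance zero for [pdist]; their final elements are kept in order to
    evaluate them. *)
Definition point := {om : state | exists e, normal s0 e om.1}.

Definition pdist (p q : point) := prefix_dist (sval p).1 (sval q).1.

Fact pact_subproof z (p : point) :
  exists e, normal s0 e (wact (word s0 (pi1_repr z)) (sval p)).1.
Proof. by case: p => om [e n]; exists e; apply: normal_wact n; apply: word_typed. Qed.

Definition pact z (p : point) : point := exist _ _ (pact_subproof z p).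

Lemma point_eq (p q : point) : sval p = sval q -> p = q.
Proof.
by case: p q => [p ?] [q ?] /= e; subst q; congr exist; apply: Prop_irrelevance.
Qed.

Lemma pactE (x : expr D) (p : point) :
  sval (pact (pi1_class x) p) = wact (word s0 x) (sval p).
Proof. by case: (p) => om [e n] /=; apply: word_eq n; apply: pi1_repr_class. Qed.

Lemma pact_tree : tree_action pdist pact.
Proof.
split.
- by move=> p; apply: prefix_dist_refl.
- by move=> p q; apply: prefix_distC.
- by move=> p q r t; apply: prefix_dist_four.
- by move=> p q r; apply: prefix_dist_even.
- move=> [p [e n]] [q [e' n']].
  rewrite /pdist /= => /prefix_dist_step[l [pl lq hl]].
  have nl : exists e, normal s0 e l.
    by case: hl => -[k ->]; apply: normal_take; [exact: n | exact: n'].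
  by exists (exist _ (l, 1) nl).
- move=> z w p; apply: point_eq.
  rewrite -[z]pi1_reprK -[w]pi1_reprK [_ * _]pi1_mulE !pactE.
  exact: (wact_cat (word s0 _)).
- by move=> p; apply: point_eq; rewrite [1]/(pi1_class _) pactE.
- move=> z [p [e n]] [q [e' n']].
  exact: prefix_dist_wact (word_typed _ _) n n'.
(* Going from [p] to [z p] and from there back to [p] would change the exponent
   sum twice by the same amount. *)
- move=> z p d1 /prefix_dist_eq0; have := exponent_sum_step d1.
  rewrite /= !exponent_sum_wact.
  move=> ne /(congr1 (@exponent_sum D)); rewrite !exponent_sum_wact.
  by lia.
Qed.

Lemma eval_pact z (p : point) e : normal s0 e (sval p).1 ->
  eval e (sval (pact z p)) = z * eval e (sval p).
Proof.
by move=> n; rewrite /= (eval_wact (word_typed s0 _) n) word_eval_word pi1_reprK.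
Qed.

(** The stabilizer of the vertex [l] is the conjugate by the value of [l] of the
    vertex group at the end of [l]. *)
Lemma fix_point_conj z (p : point) : pdist p (pact z p) = 0 ->
  exists (s : vertex D) (g : pi1 D), vertex_subgroup s (g^-1 * z * g).
Proof.
move=> /prefix_dist_eq0 el; have [e n] := svalP p; exists e, (eval e (sval p)).
have := eval_pact z n.
case: (sval p) (sval (pact z p)) el {n} => l h [l' h'] /= <-.
move=> ez; rewrite -mulgA -ez /eval /= invgM.
rewrite -!mulgA mulKg; exists ((h e)^-1 * h' e) => //.
rewrite iotaM; congr (_ * _).
by apply/esym/mulg1_eq; rewrite -iotaM mulgV; apply: ev1.
Qed.
End Action.

Theorem mainTheorem8 (D : decomposed_gg) (hD : without_circuit D)
    (u : pi1 D) (hu : u <> 1) :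
  [/\ (exists s : vertex D, vertex_subgroup s u)
        \/ in_conj_vertex u \/ ~ in_conj_vertex u,
      forall s : vertex D, vertex_subgroup s u ->
        centralizer u = vertex_subgroup s `&` centralizer u
    & ~ in_conj_vertex u -> infinite_cyclic (centralizer u)].
Proof.
split.
- by right; apply: EM.
- move=> s us; rewrite eqEsubset; split=> z; last by case.
  by move=> zu; split=> //; apply: centralizer_vertex zu.
move=> nu.
have [[_ [s0 _] _ _] _] := @tree_maximal D.
have conj_in s (g z : pi1 D) :
    vertex_subgroup s (g^-1 * z * g) -> in_conj_vertex z.
  move=> v; exists s, g; exists (g^-1 * z * g) => //.
  by rewrite !mulgA mulgV mul1g mulgK.
have n0 : normal s0 s0 (([::], 1) : seq (ambient D * edge D) * ambient D).1.
  by rewrite /= eqxx.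
pose p0 : point s0 := exist _ _ (ex_intro _ s0 n0).
have [|th [thM th0]] := translation_length (pact_tree s0) (u := u) p0.
  by move=> p /fix_point_conj[s [g /conj_in]].
apply: (centralizer_infinite_cyclic (th := th)) => // z zu thz.
(* [z] is conjugate into a vertex group and commutes with [u]. *)
have [p /fix_point_conj[s [g v]]] := th0 z zu thz.
apply: contrapT => z1; apply: nu; apply: (@conj_in s g).
apply: (centralizer_vertex hD _ v).
  move=> e; apply: z1; apply: (@mulgI _ g^-1); apply: (@mulIg _ g).
  by rewrite e mulg1 mulVg.
have conjM x y : g^-1 * x * g * (g^-1 * y * g) = g^-1 * (x * y) * g.
  by rewrite !mulgA mulgK.
by rewrite /commute !conjM zu.
Qed.
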